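(* Let $C_1$ be the one-point compactification assignment on $\mathcal{I}_1$. The assignment $G:\mathbf{UBunC^*Alg}_{C_1(\mathcal{I}_1)}\to\mathbf{C^*Alg}$ given on objects by $$\left(\left(\mathfrak{A}_\hbar,\phi^{C_1(I)}_\hbar\right)_{\hbar\in C_1(I)},\mathfrak{A}\right)\mapsto\mathfrak{A}_{0_I}$$ and sending a morphism $\sigma=(C_1(\alpha),\beta)$ (with $\alpha:I\to J$) to the map $\sigma_0:\mathfrak{A}_{0_I}\to\mathfrak{B}_{0_J}$ given by $\sigma_0\left(\phi^{C_1(I)}_{0_I}(a)\right):=\phi^{C_1(J)}_{0_J}(\beta(a))$ for $a\in\mathfrak{A}$, is a functor.
   Context: For a metric space $I$, $UC_b(I)$ is the C*-algebra of bounded uniformly continuous functions $I\to\mathbb{C}$. C*-algebras are not assumed unital. A $UC_b$ bundle of C*-algebras over a metric space $I$, written $((\mathfrak{A}_\hbar,\phi^I_\hbar)_{\hbar\in I},\mathfrak{A})$, is a family of C*-algebras $(\mathfrak{A}_\hbar)_{\hbar\in I}$, a C*-algebra $\mathfrak{A}$, and *-homomorphisms $\phi^I_\hbar:\mathfrak{A}\to\mathfrak{A}_\hbar$ such that: (i) each $\phi^I_\hbar$ is surjective and $\|a\|=\sup_{\hbar\in I}\|\phi^I_\hbar(a)\|_\hbar$ for all $a\in\mathfrak{A}$; (ii) for each $f\in UC_b(I)$ and $a\in\mathfrak{A}$ there is an element $fa\in\mathfrak{A}$ with $\phi^I_\hbar(fa)=f(\hbar)\phi^I_\hbar(a)$ for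 all $\hbar\in I$; (iii) for each $a\in\mathfrak{A}$, the function $\hbar\mapsto\|\phi^I_\hbar(a)\|_\hbar$ is in $UC_b(I)$. A homomorphism from $\mathcal{A}_I=((\mathfrak{A}_\hbar,\phi^I_\hbar)_{\hbar\in I},\mathfrak{A})$ to $\mathcal{B}_J=((\mathfrak{B}_\hbar,\phi^J_\hbar)_{\hbar\in J},\mathfrak{B})$ is a pair $\sigma=(\alpha,\beta)$ where $\alpha:I\to J$ is a metric map (i.e. $d_J(\alpha(x),\alpha(y))\le d_I(x,y)$), $\beta:\mathfrak{A}\to\mathfrak{B}$ is a *-homomorphism, and for all $a_1,a_2\in\mathfrak{A}$, $\hbar\in I$: if $\phi^I_\hbar(a_1)=\phi^I_\hbar(a_2)$, then $\phi^J_{\alpha(\hbar)}(\beta(a_1))=\phi^J_{\alpha(\hbar)}(\beta(a_2))$. Composition is componentwise. $\mathcal{I}_1$ is the collection of all locally compact, non-compact metric spaces $I$ whose one-point compactification $\dot I=I\cup\{0_I\}$ is metrizable by a metric for which the canonical embedding $\iota:I\to\dot I$ is isometric; $C_1(I):=\dot I$ with this metric, $\alpha_I:=\iota$, and $0_I$ is the unique point of $C_1(I)\setminus\alpha_I[I]$. For a proper metric map $\alpha:I\to J$ (proper: preimages of compact sets are compact), $C_1(\alpha):C_1(I)\to C_1(J)$ is its extension with $C_1(\alpha)(0_I)=0_J$. $\mathbf{UBunC^*Alg}_{C_1(\mathcal{I}_1)}$ has as objects the $UC_b$ bundles of C*-algebras over spaces $C_1(I)$, $I\in\mathcal{I}_1$,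 and as morphisms the bundle homomorphisms whose base map is of the form $C_1(\alpha)$ for a proper metric map $\alpha:I\to J$. $\mathbf{C^*Alg}$ is the category of C*-algebras and *-homomorphisms. *)

(* Defs.v *)
From HB Require Import structures.
From mathcomp Require Import all_boot all_order all_algebra.
From mathcomp Require Import complex.
From mathcomp Require Import all_classical all_reals all_analysis.
From mathcomp Require Import lra.

Set Implicit Arguments.
Unset Strict Implicit.
Unset Printing Implicit Defensive.

Import Order.TTheory GRing.Theory Num.Theory.
Import numFieldNormedType.Exports.

Local Open Scope classical_set_scope.
Local Open Scope complex_scope.
Local Open Scope ring_scope.

Record category := Category {
  obj :> Type;
  mor : obj -> obj -> Type;
  idmor : forall X, mor X X;
  compmor : forall X Y Z, mor Y Z -> mor X Y -> mor X Z;
  comp_idl : forall X Y (f : mor X Y), compmor (idmor Y) f = f;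
  comp_idr : forall X Y (f : mor X Y), compmor f (idmor X) = f;
  comp_assoc : forall W X Y Z (h : mor Y Z) (g : mor X Y) (f : mor W X),
    compmor h (compmor g f) = compmor (compmor h g) f
}.

Arguments mor {c} X Y.
Arguments idmor {c} X.
Arguments compmor {c X Y Z} g f.

Record is_functor (C D : category) (F0 : C -> D)
    (F1 : forall X Y : C, mor X Y -> mor (F0 X) (F0 Y)) : Prop := IsFunctor {
  functor_id : forall X, F1 X X (idmor X) = idmor (F0 X);
  functor_comp : forall X Y Z (g : mor Y Z) (f : mor X Y),
    F1 X Z (compmor g f) = compmor (F1 Y Z g) (F1 X Y f)
}.

(* MathComp rings have a unit, so the product is a separate operation. *)
HB.mixin Record CompleteNormedModule_isCStarAlgebra (R : realType) A
    & CompleteNormedModule R[i] A := {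
  cmul : A -> A -> A;
  cstar : A -> A;
  cmulA : forall x y z, cmul x (cmul y z) = cmul (cmul x y) z;
  cmulDl : forall x y z, cmul (x + y) z = cmul x z + cmul y z;
  cmulDr : forall x y z, cmul x (y + z) = cmul x y + cmul x z;
  cmulZl : forall (k : R[i]) x y, cmul (k *: x) y = k *: cmul x y;
  cmulZr : forall (k : R[i]) x y, cmul x (k *: y) = k *: cmul x y;
  cnormM : forall x y, `|cmul x y| <= `|x| * `|y|;
  cstarK : forall x, cstar (cstar x) = x;
  cstarD : forall x y, cstar (x + y) = cstar x + cstar y;
  cstarZ : forall (k : R[i]) x, cstar (k *: x) = conjc k *: cstar x;
  cstarM : forall x y, cstar (cmul x y) = cmul (cstar y) (cstar x);
  cstar_norm : forall x, `|cmul (cstar x) x| = `|x| ^+ 2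
}.

#[short(type="cstarAlgType")]
HB.structure Definition CStarAlgebra (R : realType) :=
  {A of CompleteNormedModule R[i] A
      & CompleteNormedModule_isCStarAlgebra R A}.

(* [`|a|] is an element of R[i] with zero imaginary part. *)
Definition rnorm (R : realType) (A : cstarAlgType R) (a : A) : R :=
  complex.Re `|a|.

Record starHom (R : realType) (A B : cstarAlgType R) := StarHom {
  starHom_fun :> {linear A -> B};
  starHomM : forall x y, starHom_fun (cmul x y) =
                         cmul (starHom_fun x) (starHom_fun y);
  starHomS : forall x, starHom_fun (cstar x) = cstar (starHom_fun x)
}.

Lemma starHom_ext (R : realType) (A B : cstarAlgType R) (f g : starHom A B) :
  f =1 g -> f = g.
Proof.
case: f => f fM fS; case: g => g gM gS /= fg.
have {}fg : f = g.
  case: f g fg {fM fS gM gS} => f cf [g cg] /= /funext fg; subst g.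
  case: cf cg => [a b] [c d].
  case: a c => a [c].
  case: b d => b [d].
  by rewrite (Prop_irrelevance a c) (Prop_irrelevance b d).
subst g.
by rewrite (Prop_irrelevance fM gM) (Prop_irrelevance fS gS).
Qed.

Section CStarCategory.
Variable R : realType.
Implicit Types A B C : cstarAlgType R.

Definition starHom_id A : starHom A A :=
  @StarHom R A A (idfun : {linear A -> A}) (fun _ _ => erefl) (fun _ => erefl).

Section comp.
Variables (A B C : cstarAlgType R) (g : starHom B C) (f : starHom A B).

Let compM x y : (g \o f) (cmul x y) = cmul ((g \o f) x) ((g \o f) y).
Proof. by rewrite /= !starHomM. Qed.

Let compS x : (g \o f) (cstar x) = cstar ((g \o f) x).
Proof. by rewrite /= !starHomS. Qed.

Definition starHom_comp : starHom A C :=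
  @StarHom R A C (g \o f : {linear A -> C}) compM compS.
End comp.

Definition CStarCat : category.
Proof.
refine (@Category (cstarAlgType R) (@starHom R) starHom_id starHom_comp _ _ _);
  by move=> *; apply: starHom_ext.
Defined.

End CStarCategory.

Section Bundles.
Variable R : realType.

Definition UCb (I : metricType R) : set (I -> R[i]^o) :=
  [set f | unif_continuous f /\ bounded_fun f].

(* The supremum is taken in R: it is a genuine one because the set is bounded
   by [ev_norm_UCb], and it is 0 when [I] is empty. *)
Record UCbBundle (I : metricType R) := MkUCbBundle {
  fibre : I -> cstarAlgType R;
  sections : cstarAlgType R;
  ev : forall h : I, starHom sections (fibre h);
  ev_surj : forall h (b : fibre h), exists a, ev h a = b;
  ev_norm : forall a, rnorm a = sup [set rnorm (ev h a) | h in [set: I]];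
  ev_scale : forall f, UCb f -> forall a,
    exists fa, forall h, ev h fa = (f h : R[i]) *: ev h a;
  ev_norm_UCb : forall a, UCb (fun h => `|ev h a|)
}.

Definition metric_map (I J : metricType R) (f : I -> J) : Prop :=
  forall x y, mdist (f x) (f y) <= mdist x y.

Definition proper_map (I J : topologicalType) (f : I -> J) : Prop :=
  forall K : set J, compact K -> compact (f @^-1` K).

Record bundleHom (I J : metricType R) (A : UCbBundle I) (B : UCbBundle J) :=
  BundleHom {
  base : I -> J;
  tot : starHom (sections A) (sections B);
  base_metric : metric_map base;
  tot_compat : forall (a1 a2 : sections A) (h : I),
    ev A h a1 = ev A h a2 -> ev B (base h) (tot a1) = ev B (base h) (tot a2)
}.

Lemma bundleHom_ext (I J : metricType R) (A : UCbBundle I) (B : UCbBundle J)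
    (s t : bundleHom A B) : base s = base t -> tot s = tot t -> s = t.
Proof.
case: s t => [sb st s1 s2] [tb tt t1 t2] /= eb et; subst tb tt.
by rewrite (Prop_irrelevance s1 t1) (Prop_irrelevance s2 t2).
Qed.

Definition bundleHom_id (I : metricType R) (A : UCbBundle I) : bundleHom A A :=
  @BundleHom I I A A id (starHom_id (sections A)) (fun _ _ => lexx _)
    (fun _ _ _ e => e).

Section comp.
Variables (I J K : metricType R).
Variables (A : UCbBundle I) (B : UCbBundle J) (C : UCbBundle K).
Variables (t : bundleHom B C) (s : bundleHom A B).

Let comp_metric : metric_map (base t \o base s).
Proof.
by move=> x y; apply: le_trans (base_metric t _ _) (base_metric s _ _).
Qed.

Let comp_compat (a1 a2 : sections A) (h : I) : ev A h a1 = ev A h a2 ->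
  ev C ((base t \o base s) h) (starHom_comp (tot t) (tot s) a1) =
  ev C ((base t \o base s) h) (starHom_comp (tot t) (tot s) a2).
Proof. by move=> e; apply/tot_compat/tot_compat. Qed.

Definition bundleHom_comp : bundleHom A C :=
  BundleHom comp_metric comp_compat.
End comp.

Record is_metric (T : Type) (d : T -> T -> R) : Prop := IsMetric {
  metric_xx : forall x, d x x = 0;
  metric_eq : forall x y, d x y = 0 -> x = y;
  metric_sym : forall x y, d x y = d y x;
  metric_triangle : forall y x z, d x z <= d x y + d y z
}.

Definition metrizes (T : topologicalType) (d : T -> T -> R) : Prop :=
  is_metric d /\
  forall x : T, nbhs x =
    filter_from [set e : R | 0 < e] (fun e => [set y | d x y < e]).

Definition isometric_compactification_metric (I : metricType R)
    (d : one_point_compactification I -> one_point_compactification I -> R) :=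
  metrizes d /\ forall x y : I, d (Some x) (Some y) = mdist x y.

Record I1 := MkI1 {
  I1_space :> metricType R;
  I1_locally_compact : locally_compact [set: I1_space];
  I1_noncompact : ~ compact [set: I1_space];
  I1_metrizable : exists d, @isometric_compactification_metric I1_space d
}.

(* There is only one such metric, because [I] is dense in its
   compactification: see [C1_dist_unique]. *)
Definition C1_dist (I : I1) : option I -> option I -> R :=
  projT1 (cid (I1_metrizable I)).

Lemma C1_distP (I : I1) : @isometric_compactification_metric I (@C1_dist I).
Proof. by rewrite /C1_dist; case: cid. Qed.

Lemma C1_dist_unique (I : I1) (d : option I -> option I -> R) :
  @isometric_compactification_metric I d -> d = @C1_dist I.
Proof.
move=> dP; have cP := C1_distP I.
suff le1 (d1 d2 : option I -> option I -> R) (x : I) :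
    @isometric_compactification_metric I d1 ->
    @isometric_compactification_metric I d2 ->
    d1 None (Some x) <= d2 None (Some x).
  have eqN x : d None (Some x) = C1_dist None (Some x).
    by apply/eqP; rewrite eq_le !le1.
  apply/funext => -[x|]; apply/funext => -[y|].
  - by rewrite dP.2 cP.2.
  - by rewrite (metric_sym dP.1.1) (metric_sym cP.1.1).
  - exact: eqN.
  - by rewrite (metric_xx dP.1.1) (metric_xx cP.1.1).
move=> [[m1 n1] i1] [[m2 n2] i2]; apply/ler_addgt0Pr => e e0.
have e20 : 0 < e / 2 by rewrite divr_gt0.
have N1 : @nbhs _ (one_point_compactification I) None
    [set y | d1 None y < e / 2] by rewrite n1; exists (e / 2).
have N2 : @nbhs _ (one_point_compactification I) None
    [set y | d2 None y < e / 2] by rewrite n2; exists (e / 2).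
have [K [cK _] KN] := filterI N1 N2.
have [y Ky] : exists y, ~ K y.
  apply/existsNP => KT; apply: (@I1_noncompact I).
  by rewrite (_ : setT = K) //; apply/seteqP; split.
have [/= y1 y2] : ([set y | d1 None y < e / 2] `&`
    [set y | d2 None y < e / 2]) (Some y) by apply: KN; left; exists y.
apply: le_trans (metric_triangle m1 (Some y) _ _) _.
have := metric_triangle m2 None (Some y) (Some x).
rewrite i1 -i2 (metric_sym m2 (Some y) None) => y3.
by move: y1 y2 y3; lra.
Qed.

Definition C1 (I : I1) : Type := option I.

HB.instance Definition _ (I : I1) := Choice.on (C1 I).
HB.instance Definition _ (I : I1) := @isMetric.Build R (C1 I) (@C1_dist I)
  (metric_xx (C1_distP I).1.1) (metric_eq (C1_distP I).1.1)
  (metric_sym (C1_distP I).1.1) (metric_triangle (C1_distP I).1.1).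

Definition C1_emb (I : I1) : I -> C1 I := Some.
Definition C1_zero (I : I1) : C1 I := None.
Definition C1_map (I J : I1) (f : I -> J) : C1 I -> C1 J := omap f.

Lemma C1_emb_isometric (I : I1) (x y : I) :
  mdist (C1_emb x) (C1_emb y) = mdist x y.
Proof. exact: (C1_distP I).2. Qed.

Lemma C1_nbhsE (I : I1) (x : C1 I) :
  nbhs x = @nbhs _ (one_point_compactification I) x.
Proof.
rewrite -(@metricType_numDomainType.filter_from_mdist_nbhs R (C1 I)).
by rewrite ((C1_distP I).1.2 x).
Qed.

Record UBun := MkUBun {
  UBun_base : I1;
  UBun_bundle :> UCbBundle (C1 UBun_base)
}.

(* [alpha] is determined by [base]: it is its restriction to [UBun_base X]. *)
Record UBunHom (X Y : UBun) := MkUBunHom {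
  UBunHom_hom :> bundleHom X Y;
  UBunHom_base : exists alpha : UBun_base X -> UBun_base Y,
    [/\ metric_map alpha, proper_map alpha
      & base UBunHom_hom = C1_map alpha]
}.

Lemma UBunHom_ext (X Y : UBun) (s t : UBunHom X Y) :
  base s = base t -> tot s = tot t -> s = t.
Proof.
case: s t => [s sP] [t tP] /= eb et.
have e := bundleHom_ext eb et; subst t.
by rewrite (Prop_irrelevance sP tP).
Qed.

Lemma UBunHom_id_base (X : UBun) :
  exists alpha : UBun_base X -> UBun_base X,
    [/\ metric_map alpha, proper_map alpha
      & base (bundleHom_id X) = C1_map alpha].
Proof. by exists id; split => //; apply/funext => -[]. Qed.

Lemma UBunHom_comp_base (X Y Z : UBun) (t : UBunHom Y Z) (s : UBunHom X Y) :
  exists alpha : UBun_base X -> UBun_base Z,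
    [/\ metric_map alpha, proper_map alpha
      & base (bundleHom_comp t s) = C1_map alpha].
Proof.
case: t s => [t [b [bm bp bE]]] [s [a [am ap aE]]] /=.
exists (b \o a); split.
- by move=> x y; apply: le_trans (bm _ _) (am _ _).
- by move=> K cK; apply: (ap (b @^-1` K)); exact: bp.
- by rewrite bE aE; apply/funext => -[].
Qed.

Definition UBunHom_id (X : UBun) : UBunHom X X :=
  MkUBunHom (UBunHom_id_base X).

Definition UBunHom_comp (X Y Z : UBun) (t : UBunHom Y Z) (s : UBunHom X Y) :
  UBunHom X Z := MkUBunHom (UBunHom_comp_base t s).

Definition UBunCat : category.
Proof.
refine (@Category UBun UBunHom UBunHom_id UBunHom_comp _ _ _);
  by move=> *; apply: UBunHom_ext => //=; apply: starHom_ext.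
Defined.

Definition zero_fibre (X : UBunCat) : CStarCat R :=
  fibre (X : UBun) (C1_zero _).

Definition induces (X Y : UBunCat) (sigma : mor X Y)
    (s : mor (zero_fibre X) (zero_fibre Y)) : Prop :=
  forall a : sections (X : UBun),
    (s : starHom _ _) (ev (X : UBun) (C1_zero _) a) =
    ev (Y : UBun) (C1_zero _) (tot (sigma : UBunHom X Y) a).

End Bundles.

(* Main.v *)
From HB Require Import structures.
Require Import Defs.
From mathcomp Require Import all_boot all_order all_algebra.
From mathcomp Require Import all_classical all_reals all_analysis.

Import GRing.Theory.
Local Open Scope ring_scope.

(** The fibre at the point at infinity is a quotient of the algebra of sections:
    the evaluation there is a surjective *-homomorphism.  The base map of a
    morphism is the extension of a map between the original spaces, so it sends
    infinity to infinity, and the compatibility condition of bundle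
    homomorphisms, taken at that point, says that two sections with the same
    value at infinity have images with the same value at infinity.  So
    evaluation after the map of sections factors through the quotient
    ([starHom_factor]), and in only one way ([starHom_cancel_surj]).
    Functoriality follows from this uniqueness, because the relation [induces]
    contains the identities and is closed under composition. *)

Section Quotient.
Context {R : realType} {A B C : cstarAlgType R}.

Lemma starHom_cancel_surj (p : starHom A B) (s t : starHom B C) :
  (forall b, exists a, p a = b) -> (forall a, s (p a) = t (p a)) -> s = t.
Proof. by move=> p_surj st; apply: starHom_ext => b; have [a <-] := p_surj b. Qed.

(** The factored map sends [b] to the image under [q] of any chosen preimage of
    [b]; the choice is irrelevant since [q] is constant on the fibres of [p],
    and hence the map inherits every operation that [p] and [q] preserve. *)
Lemma starHom_factor (p : starHom A B) (q : starHom A C) :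
  (forall b, exists a, p a = b) ->
  (forall a1 a2, p a1 = p a2 -> q a1 = q a2) ->
  exists s : starHom B C, forall a, s (p a) = q a.
Proof.
move=> p_surj pq; have [g pg] := choice p_surj.
pose s b := q (g b).
have sp a : s (p a) = q a by apply: pq; rewrite pg.
have s_linear : linear s.
  move=> k x y; have [a <-] := p_surj x; have [b <-] := p_surj y.
  by rewrite -linearP !sp linearP.
pose sL : {linear B -> C} :=
  HB.pack s (GRing.isLinear.Build _ _ _ _ s s_linear).
have sM x y : sL (cmul x y) = cmul (sL x) (sL y).
  have [a <-] := p_surj x; have [b <-] := p_surj y.
  by rewrite -starHomM /= !sp starHomM.
have sS x : sL (cstar x) = cstar (sL x).
  by have [a <-] := p_surj x; rewrite -starHomS /= !sp starHomS.
by exists (StarHom sM sS).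
Qed.

End Quotient.

Section FibreAtInfinity.
Context {R : realType}.
Implicit Types X Y Z : UBunCat R.

Lemma base_zero (X Y : UBun R) (sigma : UBunHom X Y) :
  base sigma (C1_zero _) = C1_zero _.
Proof. by have [alpha [_ _ ->]] := UBunHom_base sigma. Qed.

Lemma induces_unique {X Y} {sigma : mor X Y}
    {s t : mor (zero_fibre X) (zero_fibre Y)} :
  induces sigma s -> induces sigma t -> s = t.
Proof.
move=> hs ht; apply: (starHom_cancel_surj (ev (X : UBun R) (C1_zero _))).
  exact: ev_surj.
by move=> a; rewrite hs ht.
Qed.

Lemma induces_exists X Y (sigma : mor X Y) : exists s, induces sigma s.
Proof.
apply: (starHom_factor (ev (X : UBun R) (C1_zero _))
  (starHom_comp (ev (Y : UBun R) (C1_zero _)) (tot (sigma : UBunHom X Y)))).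
  exact: ev_surj.
move=> a1 a2 /(tot_compat (sigma : UBunHom X Y)).
by rewrite base_zero.
Qed.

Lemma induces_id X : induces (idmor X) (idmor (zero_fibre X)).
Proof. by []. Qed.

Lemma induces_comp X Y Z (tau : mor Y Z) (sigma : mor X Y) t s :
  induces tau t -> induces sigma s ->
  induces (compmor tau sigma) (compmor t s).
Proof. by move=> ht hs a /=; rewrite hs ht. Qed.

End FibreAtInfinity.

Theorem proposition5p2 (R : realType) :
  exists G1 : forall X Y : UBunCat R,
      mor X Y -> mor (zero_fibre X) (zero_fibre Y),
    (forall (X Y : UBunCat R) (sigma : mor X Y),
        unique (induces sigma) (G1 X Y sigma)) /\
    is_functor G1.
Proof.
pose G1 (X Y : UBunCat R) (sigma : mor X Y) :=
  projT1 (cid (induces_exists X Y sigma)).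
have G1P X Y sigma : induces sigma (G1 X Y sigma).
  exact: projT2 (cid (induces_exists X Y sigma)).
exists G1; split=> [X Y sigma|].
  by split=> // s; apply: induces_unique.
split=> [X|X Y Z tau sigma].
  exact: induces_unique (G1P _ _ _) (induces_id X).
by apply: induces_unique (G1P _ _ _) _; apply: induces_comp.
Qed.
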